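(* Let $E$ be a row-finite directed graph and let $A$ be an arbitrary $\mathbb{B}$-algebra over the Boolean semifield $\mathbb{B}$. A hemiring homomorphism $\phi\colon L_{\mathbb{B}}(E)\to A$ is injective if and only if the following two conditions are satisfied: (1) $\phi(v)\ne0$ for all $v\in E^0$; (2) $\phi(p(c))\neq\phi(q(c))$ for all cycles $c$ in $E$ without exits and all distinct polynomials $p(x),q(x)\in\mathbb{B}[x,x^{-1}]$.
   Context: The Boolean semifield is $\mathbb{B}=(\{0,1\},\vee,\wedge,0,1)$. A $\mathbb{B}$-algebra is a $\mathbb{B}$-semimodule (commutative monoid with unital $\mathbb{B}$-action, so idempotent addition) with an associative bilinear multiplication, not necessarily unital. A hemiring homomorphism is a map preserving $0$, $+$ and multiplication. A directed graph $E=(E^0,E^1,s,r)$ has disjoint sets $E^0$ of vertices, $E^1$ of edges and maps $s,r\colon E^1\to E^0$. It is row-finite if $|s^{-1}(v)|<\infty$ for all $v\in E^0$. A vertex $v$ is regular if $0<|s^{-1}(v)|<\infty$. A path is a sequence $p=e_1\dots e_n$ of edges with $r(e_i)=s(e_{i+1})$, with $s(p)=s(e_1)$, $r(p)=r(e_n)$; vertices are paths of length $0$. A cycle based at $v$ is a path $c=e_1\dots e_n$ with $n\ge1$, $s(c)=r(c)=v$ and $s(e_1),\dots,s(e_n)$ distinct. An exit for $c$ is an edge $f$ with $s(f)=s(e_i)$ and $f\neq e_i$ for some $i$. $L_{\mathbb{B}}(E)$ (the Leavitt path algebra) is the (not necessarily unital) $\mathbb{B}$-algebra generated by $E^0\cup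 E^1\cup\{e^*\mid e\in E^1\}$ subject to: (1) $vw=\delta_{v,w}v$ for $v,w\in E^0$; (2) $s(e)e=e=er(e)$ and $r(e)e^*=e^*=e^*s(e)$ for $e\in E^1$; (3) $e^*f=\delta_{e,f}r(e)$ for $e,f\in E^1$; (4) $v=\sum_{e\in s^{-1}(v)}ee^*$ for every regular vertex $v$. That is, it is the quotient of the free $\mathbb{B}$-algebra on these generators by the congruence generated by these relations. For a path $p=e_1\dots e_n$, $p^*=e_n^*\dots e_1^*$. $\mathbb{B}[x,x^{-1}]$ is the semiring of Laurent polynomials over $\mathbb{B}$. For a cycle $c$ based at $v$, set $c^0=v$ and $c^{-n}=(c^* )^n$ for $n\in\mathbb{N}$, and for $p(x)=\sum_{i=m}^n s_ix^i\in\mathbb{B}[x,x^{-1}]$ (with $m\le n$ integers) set $p(c)=\sum_{i=m}^n s_ic^i\in L_{\mathbb{B}}(E)$. *)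

(* Defs.v *)
From HB Require Import structures.
From mathcomp Require Import all_boot all_order all_algebra.
From mathcomp Require Import finmap.
From mathcomp Require Import boolp classical_sets functions cardinality fsbigop.

Set Implicit Arguments.
Unset Strict Implicit.
Unset Printing Implicit Defensive.

Import GRing.Theory.
Local Open Scope quotient_scope.
Local Open Scope ring_scope.

(* An alias of [bool]: MathComp equips [bool] itself with the structure of the
   field with two elements, whose addition is exclusive or. *)
Definition boolean : Type := bool.

HB.instance Definition _ := Finite.on boolean.

HB.instance Definition _ :=
  GRing.isNmodule.Build boolean orbA orbC orFb.

Fact boolean_oner_neq0 : true != false :> boolean. Proof. by []. Qed.

HB.instance Definition _ :=
  GRing.Nmodule_isComNzSemiRing.Build boolean
    andbA andbC andTb andb_orl andFb boolean_oner_neq0.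

HB.mixin Record LSemiModule_isHemiAlgebra (S : comPzSemiRingType) A
    of GRing.LSemiModule S A := {
  hmul : A -> A -> A;
  hmulA : associative hmul;
  hmulDl : left_distributive hmul +%R;
  hmulDr : right_distributive hmul +%R;
  hscaleAl : forall (k : S) (x y : A), k *: hmul x y = hmul (k *: x) y;
  hscaleAr : forall (k : S) (x y : A), k *: hmul x y = hmul x (k *: y)
}.

#[short(type="hemialgType")]
HB.structure Definition HemiAlgebra (S : comPzSemiRingType) :=
  {A of GRing.LSemiModule S A & LSemiModule_isHemiAlgebra S A}.

Notation "x *h y" := (hmul x y) (at level 40, left associativity) : ring_scope.

(* [x0] is the value of the empty product, since [A] may have no unit. *)
Definition hprod (S : comPzSemiRingType) (A : hemialgType S) (x0 : A)
    (s : seq A) : A :=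
  if s is x :: s' then foldl hmul x s' else x0.

(* There is no condition on scalars: this is a morphism of hemirings. *)
Definition hemiring_hom (S T : comPzSemiRingType) (A : hemialgType S)
    (B : hemialgType T) (f : A -> B) : Prop :=
  [/\ f 0 = 0, {morph f : x y / x + y} & {morph f : x y / x *h y}].

Section Congruence.
Variables (S : comPzSemiRingType) (A : hemialgType S).
Variable R : A -> A -> Prop.

Inductive congr_gen : A -> A -> Prop :=
| congr_gen_base x y : R x y -> congr_gen x y
| congr_gen_refl x : congr_gen x x
| congr_gen_sym x y : congr_gen x y -> congr_gen y x
| congr_gen_trans x y z : congr_gen x y -> congr_gen y z -> congr_gen x z
| congr_gen_add x x' y y' :
    congr_gen x x' -> congr_gen y y' -> congr_gen (x + y) (x' + y')
| congr_gen_scale (k : S) x x' :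
    congr_gen x x' -> congr_gen (k *: x) (k *: x')
| congr_gen_mul x x' y y' :
    congr_gen x x' -> congr_gen y y' -> congr_gen (x *h y) (x' *h y').

Definition congr_genb : rel A := fun x y => `[< congr_gen x y >].

Lemma congr_genb_refl : reflexive congr_genb.
Proof. by move=> x; apply/asboolP/congr_gen_refl. Qed.

Lemma congr_genb_sym : symmetric congr_genb.
Proof. by move=> x y; apply/asboolP/asboolP; apply: congr_gen_sym. Qed.

Lemma congr_genb_trans : transitive congr_genb.
Proof.
move=> y x z /asboolP xy /asboolP yz; apply/asboolP.
exact: congr_gen_trans xy yz.
Qed.

Canonical congr_equiv :=
  EquivRel congr_genb congr_genb_refl congr_genb_sym congr_genb_trans.

Definition quot_alg : Type := {eq_quot congr_genb}.

HB.instance Definition _ := Choice.on quot_alg.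
HB.instance Definition _ := EqQuotient.on quot_alg.

Definition quot_proj (x : A) : quot_alg := \pi_quot_alg x.

Lemma quot_projP x y : quot_proj x = quot_proj y <-> congr_gen x y.
Proof. by split=> [/eqquotP/asboolP|?]; last apply/eqquotP/asboolP. Qed.

Lemma repr_congr x : congr_gen (repr (quot_proj x)) x.
Proof. by apply/quot_projP; rewrite /quot_proj reprK. Qed.

Definition quot_add (x y : quot_alg) : quot_alg :=
  quot_proj (repr x + repr y).
Definition quot_scale (k : S) (x : quot_alg) : quot_alg :=
  quot_proj (k *: repr x).
Definition quot_mul (x y : quot_alg) : quot_alg :=
  quot_proj (repr x *h repr y).

Lemma quot_addE x y :
  quot_add (quot_proj x) (quot_proj y) = quot_proj (x + y).
Proof. by apply/quot_projP/congr_gen_add; apply: repr_congr. Qed.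

Lemma quot_scaleE k x : quot_scale k (quot_proj x) = quot_proj (k *: x).
Proof. by apply/quot_projP/congr_gen_scale/repr_congr. Qed.

Lemma quot_mulE x y :
  quot_mul (quot_proj x) (quot_proj y) = quot_proj (x *h y).
Proof. by apply/quot_projP/congr_gen_mul; apply: repr_congr. Qed.

Lemma quot_ind (P : quot_alg -> Prop) :
  (forall x, P (quot_proj x)) -> forall x, P x.
Proof. by move=> H x; rewrite -[x]reprK; apply: H. Qed.

Lemma quot_addA : associative quot_add.
Proof.
by do 3![elim/quot_ind=> ?]; rewrite !quot_addE addrA.
Qed.
Lemma quot_addC : commutative quot_add.
Proof. by do 2![elim/quot_ind=> ?]; rewrite !quot_addE addrC. Qed.
Lemma quot_add0 : left_id (quot_proj 0) quot_add.
Proof. by elim/quot_ind=> ?; rewrite !quot_addE add0r. Qed.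

HB.instance Definition _ :=
  GRing.isNmodule.Build quot_alg quot_addA quot_addC quot_add0.

Lemma quot_projD x y : quot_proj (x + y) = quot_proj x + quot_proj y.
Proof. by rewrite -quot_addE. Qed.

Lemma quot_scaleA a b v : quot_scale a (quot_scale b v) = quot_scale (a * b) v.
Proof. by elim/quot_ind: v => v; rewrite !quot_scaleE scalerA. Qed.
Lemma quot_scale0 v : quot_scale 0 v = 0.
Proof. by elim/quot_ind: v => v; rewrite !quot_scaleE scale0r. Qed.
Lemma quot_scale1 : left_id 1 quot_scale.
Proof. by elim/quot_ind=> v; rewrite !quot_scaleE scale1r. Qed.
Lemma quot_scaleDr : right_distributive quot_scale +%R.
Proof.
by move=> k; do 2![elim/quot_ind=> ?]; rewrite !(quot_scaleE, =^~ quot_projD) scalerDr.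
Qed.
Lemma quot_scaleDl v : {morph quot_scale^~ v : a b / a + b}.
Proof.
by move=> a b; elim/quot_ind: v => v; rewrite !(quot_scaleE, =^~ quot_projD) scalerDl.
Qed.

HB.instance Definition _ :=
  GRing.Nmodule_isLSemiModule.Build S quot_alg
    quot_scaleA quot_scale0 quot_scale1 quot_scaleDr quot_scaleDl.

Lemma quot_projZ k x : quot_proj (k *: x) = k *: quot_proj x.
Proof. by rewrite -quot_scaleE. Qed.

Lemma quot_mulA : associative quot_mul.
Proof. by do 3![elim/quot_ind=> ?]; rewrite !quot_mulE hmulA. Qed.
Lemma quot_mulDl : left_distributive quot_mul +%R.
Proof.
by do 3![elim/quot_ind=> ?]; rewrite !(quot_mulE, =^~ quot_projD) hmulDl.
Qed.
Lemma quot_mulDr : right_distributive quot_mul +%R.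
Proof.
by do 3![elim/quot_ind=> ?]; rewrite !(quot_mulE, =^~ quot_projD) hmulDr.
Qed.
Lemma quot_scaleAl k x y : k *: quot_mul x y = quot_mul (k *: x) y.
Proof.
elim/quot_ind: x => x; elim/quot_ind: y => y.
by rewrite -quot_projZ !quot_mulE -quot_projZ hscaleAl.
Qed.
Lemma quot_scaleAr k x y : k *: quot_mul x y = quot_mul x (k *: y).
Proof.
elim/quot_ind: x => x; elim/quot_ind: y => y.
by rewrite -quot_projZ !quot_mulE -quot_projZ hscaleAr.
Qed.

HB.instance Definition _ :=
  LSemiModule_isHemiAlgebra.Build S quot_alg
    quot_mulA quot_mulDl quot_mulDr quot_scaleAl quot_scaleAr.

Lemma quot_projM x y : quot_proj (x *h y) = quot_proj x *h quot_proj y.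
Proof. by rewrite -quot_mulE. Qed.

End Congruence.

Section FreeAlgebra.
Variable X : choiceType.

(* The pair [(x, s)] stands for the nonempty word [x :: s]. *)
Definition nword : Type := (X * seq X)%type.

HB.instance Definition _ := Choice.on nword.

Definition nword_cat (u v : nword) : nword := (u.1, u.2 ++ v.1 :: v.2).

Lemma nword_catA : associative nword_cat.
Proof. by case=> x s [y t] [z w]; rewrite /nword_cat /= -catA. Qed.

(* A formal sum of words with coefficients in [boolean] is determined by its
   support, which is an arbitrary finite set of words. *)
Definition free_alg : Type := {fset nword}.

HB.instance Definition _ := Choice.on free_alg.

HB.instance Definition _ :=
  GRing.isNmodule.Build free_alg
    (@fsetUA _ : associative (fun a b : free_alg => (a `|` b)%fset : free_alg))
    (@fsetUC _) (@fset0U _).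

Definition free_scale (k : boolean) (a : free_alg) : free_alg :=
  if k then a else fset0.

Lemma free_scaleA a b v : free_scale a (free_scale b v) = free_scale (a * b) v.
Proof. by case: a. Qed.
Lemma free_scale0 v : free_scale 0 v = 0. Proof. by []. Qed.
Lemma free_scale1 : left_id 1 free_scale. Proof. by []. Qed.
Lemma free_scaleDr : right_distributive free_scale +%R.
Proof. by case=> // a b; rewrite /= addr0. Qed.
Lemma free_scaleDl v : {morph free_scale^~ v : a b / a + b}.
Proof.
case; case=> /=; rewrite ?add0r ?addr0 //.
by rewrite /GRing.add /= fsetUid.
Qed.

HB.instance Definition _ :=
  GRing.Nmodule_isLSemiModule.Build boolean free_alg
    free_scaleA free_scale0 free_scale1 free_scaleDr free_scaleDl.

Definition free_mul (a b : free_alg) : free_alg :=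
  [fset nword_cat u v | u in a, v in b]%fset.

Lemma free_mulP (w : nword) (a b : free_alg) :
  reflect (exists2 u, u \in (a : {fset nword}) &
             exists2 v, v \in (b : {fset nword}) & w = nword_cat u v)
    (w \in (free_mul a b : {fset nword})).
Proof.
apply: (iffP idP) => [/imfset2P|] -[u ua [v vb ->]].
  by exists u => //; exists v.
by apply/imfset2P; exists u => //; exists v.
Qed.

Lemma free_mulA : associative free_mul.
Proof.
move=> a b c; apply/fsetP => w; apply/free_mulP/free_mulP.
  case=> u ua [_ /free_mulP [v vb [t tc ->]] ->].
  exists (nword_cat u v); last by exists t => //; rewrite nword_catA.
  by apply/free_mulP; exists u => //; exists v.
case=> _ /free_mulP [u ua [v vb ->]] [t tc ->].
exists u => //; exists (nword_cat v t); last by rewrite nword_catA.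
by apply/free_mulP; exists v => //; exists t.
Qed.

Lemma free_mulDl : left_distributive free_mul +%R.
Proof.
move=> a b c; apply/fsetP => w; apply/free_mulP/fsetUP.
  case=> u /fsetUP [uu|uu] [v vc ->]; [left|right];
    by apply/free_mulP; exists u => //; exists v.
case=> /free_mulP [u uu [v vc ->]]; exists u; do ?by exists v.
  by apply/fsetUP; left.
by apply/fsetUP; right.
Qed.

Lemma free_mulDr : right_distributive free_mul +%R.
Proof.
move=> a b c; apply/fsetP => w; apply/free_mulP/fsetUP.
  case=> u ua [v /fsetUP [vv|vv] ->]; [left|right];
    by apply/free_mulP; exists u => //; exists v.
case=> /free_mulP [u ua [v vv ->]]; exists u => //; exists v => //.
  by apply/fsetUP; left.
by apply/fsetUP; right.
Qed.

Lemma free_mul0l b : free_mul 0 b = 0.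
Proof.
by apply/fsetP => w; rewrite in_fset0; apply/negbTE/free_mulP => -[u].
Qed.
Lemma free_mul0r a : free_mul a 0 = 0.
Proof.
by apply/fsetP => w; rewrite in_fset0; apply/negbTE/free_mulP => -[u _ [v]].
Qed.

Lemma free_scaleAl (k : boolean) (a b : free_alg) :
  k *: free_mul a b = free_mul (k *: a) b.
Proof. by case: k => //; rewrite /GRing.scale /= free_mul0l. Qed.
Lemma free_scaleAr (k : boolean) (a b : free_alg) :
  k *: free_mul a b = free_mul a (k *: b).
Proof. by case: k => //; rewrite /GRing.scale /= free_mul0r. Qed.

HB.instance Definition _ :=
  LSemiModule_isHemiAlgebra.Build boolean free_alg
    free_mulA free_mulDl free_mulDr free_scaleAl free_scaleAr.

Definition free_gen (x : X) : free_alg := [fset ((x, [::]) : nword)]%fset.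

End FreeAlgebra.

Record digraph := Digraph {
  vertex : choiceType;
  edge : choiceType;
  src : edge -> vertex;
  tgt : edge -> vertex
}.

Section Graph.
Variable E : digraph.
Local Open Scope classical_set_scope.

Definition out_edges (v : vertex E) : set (edge E) := [set e | src e = v].

Definition row_finite : Prop := forall v, finite_set (out_edges v).

Definition regular (v : vertex E) : Prop :=
  out_edges v !=set0 /\ finite_set (out_edges v).

(* A path of positive length is given by its sequence of edges; [is_path]
   also holds of the empty sequence. *)
Definition is_path (p : seq (edge E)) : bool :=
  sorted [rel e f | tgt e == src f] p.

(* [c] is based at [v] *)
Definition is_cycle (v : vertex E) (c : seq (edge E)) : bool :=
  if c is e :: c' then
    [&& is_path c, src e == v, tgt (last e c') == v & uniq (map (@src E) c)]
  else false.

Definition is_exit (c : seq (edge E)) (f : edge E) : Prop :=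
  exists2 e, e \in c & src f = src e /\ f <> e.

End Graph.

Section Leavitt.
Variable E : digraph.

Definition lpa_generator : choiceType := (vertex E + (edge E + edge E))%type.

Local Notation F := (free_alg lpa_generator).

Definition gen_vertex (v : vertex E) : F := free_gen (inl v : lpa_generator).
Definition gen_edge (e : edge E) : F :=
  free_gen (inr (inl e) : lpa_generator).
Definition gen_ghost (e : edge E) : F :=
  free_gen (inr (inr e) : lpa_generator).

Inductive lpa_rel : F -> F -> Prop :=
| lpa_vertex v w :
    lpa_rel (gen_vertex v *h gen_vertex w)
            ((v == w : boolean) *: gen_vertex v)
| lpa_src_edge e : lpa_rel (gen_vertex (src e) *h gen_edge e) (gen_edge e)
| lpa_edge_tgt e : lpa_rel (gen_edge e *h gen_vertex (tgt e)) (gen_edge e)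
| lpa_tgt_ghost e : lpa_rel (gen_vertex (tgt e) *h gen_ghost e) (gen_ghost e)
| lpa_ghost_src e : lpa_rel (gen_ghost e *h gen_vertex (src e)) (gen_ghost e)
| lpa_ghost_edge e f :
    lpa_rel (gen_ghost e *h gen_edge f)
            ((e == f : boolean) *: gen_vertex (tgt e))
| lpa_regular v : regular v ->
    lpa_rel (gen_vertex v)
            (\sum_(e \in out_edges v) (gen_edge e *h gen_ghost e)).

Definition leavitt : hemialgType boolean := quot_alg lpa_rel.

Definition lvertex (v : vertex E) : leavitt := quot_proj lpa_rel (gen_vertex v).
Definition ledge (e : edge E) : leavitt := quot_proj lpa_rel (gen_edge e).
Definition lghost (e : edge E) : leavitt := quot_proj lpa_rel (gen_ghost e).

(* [p] and [p^*], for a path [p] whose source is [v] *)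
Definition lpath (v : vertex E) (p : seq (edge E)) : leavitt :=
  hprod (lvertex v) (map ledge p).
Definition lpath_ghost (v : vertex E) (p : seq (edge E)) : leavitt :=
  hprod (lvertex v) (rev (map lghost p)).

(* [Negz n] is [- n.+1]. *)
Definition cycle_pow (v : vertex E) (c : seq (edge E)) (i : int) : leavitt :=
  match i with
  | Posz n => hprod (lvertex v) (nseq n (lpath v c))
  | Negz n => hprod (lvertex v) (nseq n.+1 (lpath_ghost v c))
  end.

End Leavitt.

(* The finitely supported family of coefficients. *)
Definition laurent : Type := {fsfun int -> boolean with (0 : boolean)}.

Definition laurent_eval (E : digraph) (p : laurent) (v : vertex E)
    (c : seq (edge E)) : leavitt E :=
  \sum_(i <- finsupp p) p i *: cycle_pow v c i.

(* Main.v *)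
Require Import Defs.
From HB Require Import structures.
From mathcomp Require Import all_boot all_order all_algebra.
From mathcomp Require Import finmap.
From mathcomp Require Import boolp classical_sets functions cardinality fsbigop.

Set Implicit Arguments.
Unset Strict Implicit.
Unset Printing Implicit Defensive.

Import GRing.Theory.
Local Open Scope ring_scope.

(** Addition in a hemialgebra over the Boolean semifield is idempotent, so
    [x + y = y] defines an order for which sums are suprema and products are
    monotone, and every hemiring homomorphism is monotone.  Hence [phi] is
    injective as soon as it reflects this order.

    Let [phi x <= phi y].  By the relations, [x] is a sum, that is a supremum, of
    monomials [p q^*] with [p] and [q] ending at the same vertex [u]
    ([sum_of_monomial]), so that [x] may be taken to be one of them.  Multiplying
    by [p^*] on the left and by [q] on the right turns the hypothesis into
    [phi u <= phi z], where [z = p^* y q] is a sum of monomials [a b^*] with [a]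
    and [b] starting at [u].  Conversely [u <= z] gives back
    [p q^* <= p p^* y q q^* <= y], because [p p^*] lies below the source of [p]
    when the graph is row-finite ([corner_le]).  It remains to see that
    [phi u <= phi z] implies [u <= z] ([phi_reflects_lvertex]).

    If [u] is not a sink, it is the finite sum of the [e e^*] over the edges [e]
    leaving it, so that it suffices to prove [tgt e <= e^* z e] for each of them.
    This replacement decreases the smaller of the two lengths in each [a b^*]
    until it is 0, and one is left with a [z] which is a sum of closed walks at
    [u] and of their ghosts.  If one of them has length 0, then it is [u] and
    [u <= z] is clear.  Otherwise the hypothesis is contradictory
    ([phi_loops]).  For [z = 0] it is so by condition (1).  For [z <> 0], take a shortest closed walk [c] at [u]; it is a cycle.
    - If [c] has an exit [f], split [c] as [a e b] with [f] and [e] of the same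
      source, and consider the walks [c^k a f].  They are pairwise incomparable
      for the prefix order, whereas [g^* t g] can be nonzero, for a closed walk
      [t], only if [g] is a prefix of [t t t ...].  So each [t] (or [t^*]) is
      annihilated by all of them but at most one, and some [g = c^k a f] annihilates [z].  Then
      [phi (r(g)) <= 0], against condition (1).
    - If [c] has no exit, then the closed walks at [u] are the powers of [c], so
      [z] and [u + z] are the values at [c] of two Laurent polynomials, which
      differ in their constant coefficient.  As [phi (u + z) = phi z], this
      contradicts condition (2).

    For the other implication it is enough that [v <> 0] and [p(c) <> q(c)] hold
    already in the Leavitt path algebra, and this is seen in a representation by
    relations.  As every regular vertex has finitely many, say [d], outgoing
    edges, [N] is the disjoint union of [d] copies of itself, by Euclidean
    division by [d]; the edges act by these injections, and an integer component
    records the degree.  No vertex is represented by the empty relation, and the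
    degree tells the powers of a cycle apart. *)

(** * The natural order of an idempotent hemialgebra *)

Definition hle (A : hemialgType boolean) (x y : A) : Prop := x + y = y.

Notation "x <=h y" := (hle x y) (at level 70) : ring_scope.

Section NaturalOrder.
Variable A : hemialgType boolean.
Implicit Types x y z : A.

Lemma addhh : idempotent_op (+%R : A -> A -> A).
Proof.
move=> x; have -> : x + x = (1 + 1 : boolean) *: x.
  by rewrite scalerDl scale1r.
exact: scale1r.
Qed.

Lemma hmul0r x : 0 *h x = 0.
Proof. by rewrite -[X in X *h _](scale0r (0 : A)) -hscaleAl scale0r. Qed.

Lemma hmulr0 x : x *h 0 = 0.
Proof. by rewrite -[X in _ *h X](scale0r (0 : A)) -hscaleAr scale0r. Qed.

Lemma hmul_suml (I : Type) (s : seq I) F x :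
  (\sum_(i <- s) F i) *h x = \sum_(i <- s) F i *h x.
Proof.
by apply: (big_morph (hmul^~ x)) => [? ?|]; rewrite (hmulDl, hmul0r).
Qed.

Lemma hmul_sumr (I : Type) (s : seq I) F x :
  x *h (\sum_(i <- s) F i) = \sum_(i <- s) x *h F i.
Proof.
by apply: (big_morph (hmul x)) => [? ?|]; rewrite (hmulDr, hmulr0).
Qed.

Lemma hle_refl x : x <=h x. Proof. exact: addhh. Qed.

Lemma hle_trans y x z : x <=h y -> y <=h z -> x <=h z.
Proof. by rewrite /hle => xy <-; rewrite addrA xy. Qed.

Lemma hle_anti x y : x <=h y -> y <=h x -> x = y.
Proof. by rewrite /hle addrC => -> ->. Qed.

Lemma hle0 x : 0 <=h x. Proof. exact: add0r. Qed.

Lemma hle_addr x y : x <=h x + y.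
Proof. by rewrite /hle addrA addhh. Qed.

Lemma hle_addl x y : y <=h x + y.
Proof. by rewrite addrC; apply: hle_addr. Qed.

Lemma hle_add x y z : x <=h z -> y <=h z -> x + y <=h z.
Proof. by rewrite /hle -addrA => xz ->. Qed.

Lemma hle_mul x x' y y' : x <=h x' -> y <=h y' -> x *h y <=h x' *h y'.
Proof.
move=> xx' yy'; apply: (@hle_trans (x *h y')).
  by rewrite /hle -hmulDr yy'.
by rewrite /hle -hmulDl xx'.
Qed.

Lemma hle_mull z x y : x <=h y -> z *h x <=h z *h y.
Proof. exact/hle_mul/hle_refl. Qed.

Lemma hle_mulr z x y : x <=h y -> x *h z <=h y *h z.
Proof. by move=> xy; apply/hle_mul/hle_refl. Qed.

Lemma hle_sum (T : eqType) (s : seq T) (f : T -> A) z :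
  {in s, forall i, f i <=h z} -> \sum_(i <- s) f i <=h z.
Proof.
move=> fz; rewrite big_seq; elim/big_ind: _ => [|x y|]; first exact: hle0.
  exact: hle_add.
exact: fz.
Qed.

Lemma hle_bigsum (T : eqType) (s : seq T) (f : T -> A) i :
  i \in s -> f i <=h \sum_(j <- s) f j.
Proof. by move=> si; rewrite (big_rem i) //=; apply: hle_addr. Qed.

(** An inductive predicate rather than a list of summands: closure
    properties of sums then go through by induction, and [sum_of_seq] recovers
    the list in the one argument that has to inspect all summands at once. *)
Inductive sum_of (P : A -> Prop) : A -> Prop :=
| sum_of0 : sum_of P 0
| sum_of_gen x of P x : sum_of P x
| sum_ofD x y of sum_of P x & sum_of P y : sum_of P (x + y).

Lemma sum_of_seq P z :
  sum_of P z -> exists2 s : seq A, {in s, forall x, P x} & z = \sum_(x <- s) x.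
Proof.
elim=> [|x Px|x y _ [s Ps ->] _ [t Pt ->]].
- by exists [::]; rewrite ?big_nil.
- by exists [:: x]; rewrite ?big_seq1// => y; rewrite inE => /eqP ->.
- exists (s ++ t); last by rewrite big_cat.
  by move=> {}x; rewrite mem_cat => /orP[/Ps|/Pt].
Qed.

Lemma sum_of_morph (P Q : A -> Prop) (f : A -> A) z :
    f 0 = 0 -> {morph f : x y / x + y} ->
    (forall x, P x -> sum_of Q (f x)) ->
  sum_of P z -> sum_of Q (f z).
Proof.
move=> f0 fD fP; elim=> [|x /fP//|x y _ IHx _ IHy].
  by rewrite f0; apply: sum_of0.
by rewrite fD; apply: sum_ofD.
Qed.

Lemma sum_of_sandwich (P Q : A -> Prop) a b z :
    (forall x, P x -> sum_of Q (a *h x *h b)) ->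
  sum_of P z -> sum_of Q (a *h z *h b).
Proof.
apply: (sum_of_morph (f := fun x => a *h x *h b)).
  by rewrite hmulr0 hmul0r.
by move=> x y /=; rewrite hmulDr hmulDl.
Qed.

Lemma sum_of_mul (P : A -> Prop) x y :
    (forall x y, P x -> P y -> sum_of P (x *h y)) ->
  sum_of P x -> sum_of P y -> sum_of P (x *h y).
Proof.
move=> PM Px Py.
apply: (sum_of_morph (f := fun x => x *h y)) Px; first exact: hmul0r.
  by move=> ? ? /=; rewrite hmulDl.
move=> {}x Px.
apply: (sum_of_morph (f := fun y => x *h y)) Py; first exact: hmulr0.
  by move=> ? ? /=; rewrite hmulDr.
by move=> {}y /(PM _ _ Px).
Qed.

End NaturalOrder.

Lemma hom_hle (A B : hemialgType boolean) (f : A -> B) x y :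
  hemiring_hom f -> x <=h y -> f x <=h f y.
Proof. by case=> _ fD _ xy; rewrite /hle -fD xy. Qed.

(** * Walks and closed walks *)

Section Walks.
Variable E : digraph.
Implicit Types (v w : vertex E) (e f : edge E) (p q : seq (edge E)).

(** Unlike [is_path], this fixes the starting vertex, which makes the empty
    walk meaningful; the target of a walk is [wtgt]. *)
Fixpoint walk v p : bool :=
  if p is e :: p' then (src e == v) && walk (tgt e) p' else true.

Definition wtgt v p : vertex E := last v (map (@tgt E) p).

Lemma walk_cat v p q : walk v (p ++ q) = walk v p && walk (wtgt v p) q.
Proof. by elim: p v => //= e p IHp v; rewrite IHp andbA. Qed.

Lemma wtgt_cat v p q : wtgt v (p ++ q) = wtgt (wtgt v p) q.
Proof. by rewrite /wtgt map_cat last_cat. Qed.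

Lemma wtgt_cons v e p : wtgt v (e :: p) = wtgt (tgt e) p.
Proof. by []. Qed.

Definition closed_walk v p : bool := walk v p && (wtgt v p == v).

Lemma closed_walk_cat v p q :
  closed_walk v p -> closed_walk v (p ++ q) = closed_walk v q.
Proof.
by case/andP=> wp /eqP tp; rewrite /closed_walk walk_cat wtgt_cat wp tp.
Qed.

Definition seq_pow p n : seq (edge E) := flatten (nseq n p).

Lemma closed_walk_pow v p n : closed_walk v p -> closed_walk v (seq_pow p n).
Proof.
move=> cp; elim: n => [|n IHn]; first by rewrite /closed_walk /= eqxx.
by rewrite [seq_pow _ _]/= closed_walk_cat.
Qed.

Lemma seq_powD p m n : seq_pow p (m + n) = seq_pow p m ++ seq_pow p n.
Proof. by rewrite /seq_pow nseqD flatten_cat. Qed.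

Lemma size_seq_pow p n : size (seq_pow p n) = (n * size p)%N.
Proof. by elim: n => //= n IHn; rewrite size_cat IHn. Qed.

Lemma walk_is_path v e p :
  walk v (e :: p) = (src e == v) && is_path (e :: p).
Proof.
rewrite /is_path /=; congr (_ && _).
by elim: p e => //= f p IHp e; rewrite IHp (eq_sym (src f)).
Qed.

Lemma is_cycle_closed_walk v c :
  is_cycle v c <-> [/\ c != [::], closed_walk v c & uniq (map (@src E) c)].
Proof.
case: c => [|e c]; first by split=> [|[]].
rewrite /is_cycle /closed_walk walk_is_path /wtgt /= last_map.
split=> [/and4P[-> -> -> ->]//|[_ /andP[/andP[-> ->] ->] ->]//].
Qed.

Lemma shortest_closed_walk v p : closed_walk v p -> p != [::] ->
  exists c, [/\ c != [::], closed_walk v c &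
    forall q, closed_walk v q -> q != [::] -> (size c <= size q)%N].
Proof.
move=> cp p0.
have exn : exists n, `[< exists c, [/\ c != [::], closed_walk v c & size c = n] >].
  by exists (size p); apply/asboolP; exists p.
case: (ex_minnP exn) => n /asboolP[c [c0 cc <-]] minc.
exists c; split=> // q cq q0; apply: minc; apply/asboolP; by exists q.
Qed.

(** If two edges of [c] had the same source, then cutting out the part of
    [c] between them would leave a shorter closed walk at [v].  The cut keeps
    the second of these edges, so that the shorter walk is not empty. *)
Lemma shortest_closed_walk_cycle v c :
    c != [::] -> closed_walk v c ->
    (forall q, closed_walk v q -> q != [::] -> (size c <= size q)%N) ->
  is_cycle v c.
Proof.
move=> c0 cc minc; apply/is_cycle_closed_walk; split=> //.
(* Stated for suffixes of [c], so that induction on [b] applies. *)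
suff H a b : c = a ++ b -> uniq (map (@src E) b) by apply: (H [::]).
elim: b a => //= e b IHb a ceq.
rewrite (IHb (rcons a e)) ?cat_rcons// andbT.
apply/mapP => -[f bf esf]; case/splitPr: bf ceq {IHb} => p q ceq.
suff: closed_walk v (a ++ f :: q).
  move/minc; rewrite ceq !size_cat /= size_cat /=.
  by case: a {ceq} => [|? ?] /(_ isT) /=; rewrite leq_add2l ltnNge !addnS !ltnS leq_addl.
move: cc; rewrite ceq /closed_walk !(walk_cat, wtgt_cat) /= !walk_cat /=.
rewrite !wtgt_cons !wtgt_cat !wtgt_cons esf.
by case/andP=> /and4P[-> -> _ /andP[_ ->]] ->.
Qed.

Lemma prefix_seq_pow p q n : prefix q (p ++ q) -> prefix q (seq_pow p n ++ q).
Proof.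
move=> pq; elim: n => [|n IHn]; first exact: prefix_refl.
rewrite [seq_pow _ _]/= -catA.
apply: (prefix_trans pq); case/prefixP: IHn => r ->.
by rewrite catA prefix_prefix.
Qed.

Lemma prefix_comparable (p q r : seq (edge E)) :
  (size p <= size q)%N -> prefix p r -> prefix q r -> prefix p q.
Proof.
move=> pq; rewrite !prefixE => /eqP pr /eqP qr.
by rewrite -qr take_takel// pr.
Qed.

(** A word [q] is a prefix of [p ++ q] exactly when it is a prefix of the
    infinite word [p p p ...], and any two prefixes of one word are
    comparable. *)
Lemma prefix_periodic p q q' : p != [::] -> (size q <= size q')%N ->
  prefix q (p ++ q) -> prefix q' (p ++ q') -> prefix q q'.
Proof.
move=> p0 qq' pq pq'.
have long r : (size r <= size q')%N -> prefix r (p ++ r) ->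
    prefix r (seq_pow p (size q')).
  move=> rq' /(@prefix_seq_pow _ _ (size q')) pr.
  apply: prefix_comparable pr (prefix_prefix _ _).
  by rewrite size_seq_pow (leq_trans rq') // leq_pmulr // lt0n size_eq0.
exact: prefix_comparable qq' (long q qq' pq) (long q' (leqnn _) pq').
Qed.

(** After the common part [c ^ k ++ a], the shorter walk goes on with the
    exit [f] and the longer one with the edge [e] of the cycle. *)
Lemma exit_walk_incomparable a e b f k l : f != e -> (k < l)%N ->
  ~~ prefix (seq_pow (a ++ e :: b) k ++ rcons a f)
            (seq_pow (a ++ e :: b) l ++ rcons a f).
Proof.
move=> fe kl; rewrite -(subnKC kl) addSnnS seq_powD -catA.
rewrite prefix_catr ?eqxx// [seq_pow _ _.+1]/= -!catA -cats1 prefix_catr ?eqxx//=.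
by rewrite (negPf fe).
Qed.

End Walks.

(** * Monomials of the Leavitt path algebra *)

Section LeavittPaths.
Variable E : digraph.
Implicit Types (u v w : vertex E) (e f : edge E) (p q : seq (edge E)).

Lemma lvertexM v w :
  lvertex v *h lvertex w = if v == w then lvertex v else 0.
Proof.
rewrite -quot_projM (proj2 (quot_projP _ _ _) (congr_gen_base (lpa_vertex v w))).
by rewrite quot_projZ; case: eqP => _; rewrite (scale1r, scale0r).
Qed.

Lemma lvertexM_id v : lvertex v *h lvertex v = lvertex v.
Proof. by rewrite lvertexM eqxx. Qed.

Lemma lsrc_edge e : lvertex (src e) *h ledge e = ledge e.
Proof.
rewrite -quot_projM; apply/quot_projP; exact/congr_gen_base/lpa_src_edge.
Qed.

Lemma ledge_tgt e : ledge e *h lvertex (tgt e) = ledge e.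
Proof.
rewrite -quot_projM; apply/quot_projP; exact/congr_gen_base/lpa_edge_tgt.
Qed.

Lemma ltgt_ghost e : lvertex (tgt e) *h lghost e = lghost e.
Proof.
rewrite -quot_projM; apply/quot_projP; exact/congr_gen_base/lpa_tgt_ghost.
Qed.

Lemma lghost_src e : lghost e *h lvertex (src e) = lghost e.
Proof.
rewrite -quot_projM; apply/quot_projP; exact/congr_gen_base/lpa_ghost_src.
Qed.

Lemma lghost_edge e f :
  lghost e *h ledge f = if e == f then lvertex (tgt e) else 0.
Proof.
rewrite -quot_projM.
rewrite (proj2 (quot_projP _ _ _) (congr_gen_base (lpa_ghost_edge e f))).
by rewrite quot_projZ; case: eqP => _; rewrite (scale1r, scale0r).
Qed.

(** The sum over [out_edges v] in the last defining relation is a sum over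
    this list, and positions in it number the edges in the model below. *)
Definition outs v : seq (edge E) := fset_set (out_edges v).

Lemma mem_outs v e : row_finite E -> (e \in outs v) = (src e == v).
Proof.
move=> rf; rewrite /outs in_fset_set//.
by apply/idP/eqP; rewrite in_setE.
Qed.

Lemma lvertex_outs v e : row_finite E -> src e = v ->
  lvertex v = \sum_(f <- outs v) ledge f *h lghost f.
Proof.
move=> rf ev; have reg : regular v by split; [exists e | apply: rf].
rewrite [LHS](proj2 (quot_projP _ _ _) (congr_gen_base (lpa_regular reg))).
rewrite fsbig_finite ?rf//.
rewrite (big_morph (quot_proj (@lpa_rel E)) (@quot_projD _ _ _) (erefl _)).
by apply: eq_bigr => f _; rewrite quot_projM.
Qed.

Lemma ledge_ghost_le e : row_finite E -> ledge e *h lghost e <=h lvertex (src e).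
Proof.
move=> rf; rewrite (@lvertex_outs (src e) e)//.
by apply: (hle_bigsum (fun f => ledge f *h lghost f)); rewrite mem_outs.
Qed.

(** The elements [p] and [p^*], with a recursion that ends at the vertex
    reached.  They agree with [lpath] and [lpath_ghost] on walks, and satisfy
    the concatenation laws without a special case for the empty walk. *)
Fixpoint rpath v p : leavitt E :=
  if p is e :: p' then ledge e *h rpath (tgt e) p' else lvertex v.

Fixpoint gpath v p : leavitt E :=
  if p is e :: p' then gpath (tgt e) p' *h lghost e else lvertex v.

Lemma rpath_src v p : walk v p -> lvertex v *h rpath v p = rpath v p.
Proof.
case: p => [|e p] /=; first by rewrite lvertexM_id.
by case/andP=> /eqP<- _; rewrite hmulA lsrc_edge.
Qed.

Lemma gpath_src v p : walk v p -> gpath v p *h lvertex v = gpath v p.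
Proof.
case: p => [|e p] /=; first by rewrite lvertexM_id.
by case/andP=> /eqP<- _; rewrite -hmulA lghost_src.
Qed.

Lemma rpath_tgt v p : rpath v p *h lvertex (wtgt v p) = rpath v p.
Proof.
elim: p v => [|e p IHp] v /=; first by rewrite lvertexM_id.
by rewrite -hmulA IHp.
Qed.

Lemma gpath_tgt v p : lvertex (wtgt v p) *h gpath v p = gpath v p.
Proof.
elim: p v => [|e p IHp] v /=; first by rewrite lvertexM_id.
by rewrite hmulA IHp.
Qed.

Lemma rpath_cat v p q : walk (wtgt v p) q ->
  rpath v (p ++ q) = rpath v p *h rpath (wtgt v p) q.
Proof.
elim: p v => [|e p IHp] v /=; first by move/rpath_src.
by move=> wq; rewrite IHp// hmulA.
Qed.

Lemma gpath_cat v p q : walk (wtgt v p) q ->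
  gpath v (p ++ q) = gpath (wtgt v p) q *h gpath v p.
Proof.
elim: p v => [|e p IHp] v /=; first by move/gpath_src.
by move=> wq; rewrite IHp// hmulA.
Qed.

Lemma gpath_rpath_cat v p q : walk v (p ++ q) ->
  gpath v p *h rpath v (p ++ q) = rpath (wtgt v p) q.
Proof.
elim: p v => [|e p IHp] v /=; first exact: rpath_src.
case/andP=> _ wpq; rewrite hmulA -(hmulA _ (lghost e)) lghost_edge eqxx.
rewrite gpath_src ?IHp//.
by move: wpq; rewrite walk_cat => /andP[].
Qed.

Lemma gpath_cat_rpath v p q : walk v (p ++ q) ->
  gpath v (p ++ q) *h rpath v p = gpath (wtgt v p) q.
Proof.
elim: p v => [|e p IHp] v /=; first exact: gpath_src.
case/andP=> _ wpq; rewrite hmulA -(hmulA _ (lghost e)) lghost_edge eqxx.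
by rewrite gpath_src ?IHp.
Qed.

Lemma gpath_rpath0 v p q : walk v p -> walk v q ->
  ~~ prefix p q -> ~~ prefix q p -> gpath v p *h rpath v q = 0.
Proof.
elim: p v q => [|e p IHp] v [|f q] //= /andP[/eqP<- wp] /andP[_ wq].
rewrite hmulA -(hmulA _ (lghost e)) lghost_edge (eq_sym f).
case: eqVneq => [ef|_] /= npq nqp; last by rewrite hmulr0 hmul0r.
by rewrite gpath_src// -ef IHp// ef.
Qed.

(** The product [p^* q] cancels the common prefix of [p] and [q]: what
    remains is a walk, a ghost walk, or 0 when the two walks diverge. *)
Variant gpath_rpath_spec v p q : leavitt E -> Prop :=
| GpathRpathReal r of q = p ++ r :
    gpath_rpath_spec v p q (rpath (wtgt v p) r)
| GpathRpathGhost r of p = q ++ r :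
    gpath_rpath_spec v p q (gpath (wtgt v q) r)
| GpathRpath0 : gpath_rpath_spec v p q 0.

Lemma gpath_rpathP v p q : walk v p -> walk v q ->
  gpath_rpath_spec v p q (gpath v p *h rpath v q).
Proof.
move=> wp wq; case: (boolP (prefix p q)) => [/prefixP[r qe]|npq].
  by rewrite qe in wq *; rewrite gpath_rpath_cat//; apply: GpathRpathReal.
case: (boolP (prefix q p)) => [/prefixP[r pe]|nqp].
  by rewrite pe in wp *; rewrite gpath_cat_rpath//; apply: GpathRpathGhost.
by rewrite gpath_rpath0//; apply: GpathRpath0.
Qed.

Lemma rpath_gpath_le v p : row_finite E -> walk v p ->
  rpath v p *h gpath v p <=h lvertex v.
Proof.
move=> rf; elim: p v => [|e p IHp] v /=.
  by rewrite lvertexM_id => _; apply: hle_refl.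
case/andP=> /eqP<- wp; apply: hle_trans (ledge_ghost_le e rf).
rewrite hmulA -(hmulA (ledge e)); apply: hle_mulr.
by rewrite -[X in _ <=h X]ledge_tgt; apply/hle_mull/IHp.
Qed.

Definition monomial v w (x : leavitt E) : Prop :=
  exists p q, [/\ walk v p, walk w q, wtgt v p = wtgt w q
                & x = rpath v p *h gpath w q].

Lemma monomial_rpath v p : walk v p -> monomial v (wtgt v p) (rpath v p).
Proof. by move=> wp; exists p, [::]; rewrite rpath_tgt. Qed.

Lemma monomial_gpath v p : walk v p -> monomial (wtgt v p) v (gpath v p).
Proof. by move=> wp; exists [::], p; rewrite gpath_tgt. Qed.

Lemma monomial_src v w x : monomial v w x -> lvertex v *h x = x.
Proof. by case=> p [q [wp wq _ ->]]; rewrite hmulA rpath_src. Qed.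

Lemma monomial_tgt v w x : monomial v w x -> x *h lvertex w = x.
Proof. by case=> p [q [wp wq _ ->]]; rewrite -hmulA gpath_src. Qed.

Lemma monomialM u v w x y : monomial u v x -> monomial v w y ->
  x *h y = 0 \/ monomial u w (x *h y).
Proof.
move=> [a [b [wa wb ab ->]]] [c [d [wc wd cd ->]]].
rewrite hmulA -(hmulA _ (gpath v b)); case: gpath_rpathP => // [r ce|r be|].
- right; subst c; move: wc cd; rewrite walk_cat wtgt_cat -ab => /andP[_ wr] rd.
  exists (a ++ r), d; rewrite walk_cat wa wr wtgt_cat; split=> //.
  by rewrite rpath_cat.
- right; subst b; move: wb ab; rewrite walk_cat wtgt_cat cd => /andP[_ wr] ar.
  exists a, (d ++ r); rewrite walk_cat wd wr wtgt_cat; split=> //.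
  by rewrite gpath_cat// hmulA.
- by left; rewrite hmulr0 hmul0r.
Qed.

Lemma monomialM0 u v v' w x y :
  v != v' -> monomial u v x -> monomial v' w y -> x *h y = 0.
Proof.
move=> vv' /monomial_tgt<- /monomial_src<-.
by rewrite hmulA -(hmulA x) lvertexM (negPf vv') hmulr0 hmul0r.
Qed.

Definition is_monomial x := exists v w, monomial v w x.

Lemma sum_of_monomialM x y : sum_of is_monomial x -> sum_of is_monomial y ->
  sum_of is_monomial (x *h y).
Proof.
apply: sum_of_mul => {}x {}y [u [v xm]] [v' [w ym]].
case: (eqVneq v v') => [vv'|/monomialM0 /(_ xm ym) ->]; last exact: sum_of0.
rewrite -vv' in ym; case: (monomialM xm ym) => [->|xym]; first exact: sum_of0.
by apply: sum_of_gen; exists u, w.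
Qed.

Lemma free_gen_mul (X : choiceType) (g h : X) s :
  ([fset ((g, h :: s) : nword X)]%fset : free_alg X) =
  free_gen g *h ([fset ((h, s) : nword X)]%fset : free_alg X).
Proof.
apply/fsetP => w; rewrite inE; apply/eqP/free_mulP => [->|].
  by exists (g, [::]); [rewrite inE | exists (h, s); rewrite ?inE].
by case=> u /fset1P-> [v /fset1P-> ->].
Qed.

(** The generators are monomials, and the product of two monomials is again
    one, or 0. *)
Lemma sum_of_monomial x : sum_of is_monomial x.
Proof.
have gen (g : lpa_generator E) :
    sum_of is_monomial (quot_proj (@lpa_rel E) (free_gen g)).
  apply: sum_of_gen; case: g => [v|[e|e]].
  - by exists v, v; apply: (@monomial_rpath v [::]).
  - exists (src e), (tgt e); rewrite -[quot_proj _ _]/(ledge e) -ledge_tgt.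
    by apply: (@monomial_rpath (src e) [:: e]); rewrite /= eqxx.
  - exists (tgt e), (src e); rewrite -[quot_proj _ _]/(lghost e) -ltgt_ghost.
    by apply: (@monomial_gpath (src e) [:: e]); rewrite /= eqxx.
elim/quot_ind: x; elim/finSet_rect => a IHa.
case: (fset_0Vmem a) => [->|[[g s] ga]]; first exact: sum_of0.
rewrite -(fsetD1K ga) [quot_proj _ _]quot_projD; apply: sum_ofD; last first.
  by apply: IHa; apply: fproperD1.
elim: s g {a IHa ga} => [g|h s IHs g]; first exact: gen.
by rewrite free_gen_mul quot_projM; apply: sum_of_monomialM.
Qed.

Lemma lvertex_mul_le v x : lvertex v *h x <=h x.
Proof.
elim: (sum_of_monomial x) => [|{}x [u [w xm]]|{}x y _ IHx _ IHy].
- by rewrite hmulr0; apply: hle_refl.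
- rewrite -(monomial_src xm) hmulA lvertexM; case: eqP => [->|_].
    exact: hle_refl.
  by rewrite hmul0r; apply: hle0.
- rewrite hmulDr; apply: hle_add.
    exact: hle_trans IHx (hle_addr _ _).
  exact: hle_trans IHy (hle_addl _ _).
Qed.

Lemma mul_lvertex_le v x : x *h lvertex v <=h x.
Proof.
elim: (sum_of_monomial x) => [|{}x [u [w xm]]|{}x y _ IHx _ IHy].
- by rewrite hmul0r; apply: hle_refl.
- rewrite -(monomial_tgt xm) -hmulA lvertexM; case: eqP => [->|_].
    exact: hle_refl.
  by rewrite hmulr0; apply: hle0.
- rewrite hmulDl; apply: hle_add.
    exact: hle_trans IHx (hle_addr _ _).
  exact: hle_trans IHy (hle_addl _ _).
Qed.

(** Multiplication by [p] on the left and by [q^*] on the right undoes the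
    compression [z |-> p^* z q] up to the projections [p p^*] and [q q^*], which
    lie below vertices and thus only make [z] smaller. *)
Lemma corner_le v p w q z : row_finite E -> walk v p -> walk w q ->
    wtgt v p = wtgt w q ->
    lvertex (wtgt v p) <=h gpath v p *h z *h rpath w q ->
  rpath v p *h gpath w q <=h z.
Proof.
move=> rf wp wq pq /(hle_mull (rpath v p)) /(hle_mulr (gpath w q)).
rewrite rpath_tgt => /hle_trans; apply.
rewrite !hmulA -hmulA; apply: hle_trans (mul_lvertex_le w _).
apply: hle_mul; last exact: rpath_gpath_le.
exact: hle_trans (hle_mulr _ (rpath_gpath_le rf wp)) (lvertex_mul_le _ _).
Qed.

Lemma corner_monomial v p w q z : walk v p -> walk w q ->
    wtgt v p = wtgt w q -> let u := wtgt v p in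
  sum_of (monomial u u) (gpath v p *h z *h rpath w q).
Proof.
move=> wp wq pq u.
apply: sum_of_sandwich (sum_of_monomial z) => {z} x [v' [w' xm]].
have pm := monomial_gpath wp; have qm := monomial_rpath wq.
case: (eqVneq v v') => [vv'|/monomialM0 /(_ pm xm) ->]; last first.
  by rewrite hmul0r; apply: sum_of0.
rewrite -vv' in xm; case: (monomialM pm xm) => [->|pxm].
  by rewrite hmul0r; apply: sum_of0.
case: (eqVneq w' w) => [ww'|/monomialM0 /(_ pxm qm) ->]; last exact: sum_of0.
rewrite ww' in pxm; case: (monomialM pxm qm) => [->|]; first exact: sum_of0.
by rewrite -pq; apply: sum_of_gen.
Qed.

Lemma lpath_rpath v p : walk v p -> lpath v p = rpath v p.
Proof.
case: p => [|e p] //= /andP[_].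
rewrite /lpath /=; move: (ledge e) (tgt e) (ledge_tgt e).
elim: p => [|f p IHp] x w xw //=; case/andP=> /eqP fw wp.
by rewrite hmulA (IHp _ (tgt f)) // -hmulA ledge_tgt.
Qed.

Lemma hprod_rcons (A : hemialgType boolean) (x0 x : A) s :
  s != [::] \/ x0 *h x = x -> hprod x0 (rcons s x) = hprod x0 s *h x.
Proof. by case: s => [|y s] [] //= _; rewrite foldl_rcons. Qed.

Lemma lpath_ghost_gpath v p : walk v p -> lpath_ghost (wtgt v p) p = gpath v p.
Proof.
rewrite /lpath_ghost; elim: p v => [|e p IHp] v //= /andP[_ wp].
rewrite rev_cons hprod_rcons; first by rewrite IHp.
case: p {IHp wp} => [|f p]; [right | left]; first exact: ltgt_ghost.
by rewrite -size_eq0 size_rev.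
Qed.

Lemma hprod_nseqS (A : hemialgType boolean) (x0 x : A) n :
  x0 *h x = x -> hprod x0 (nseq n.+1 x) = hprod x0 (nseq n x) *h x.
Proof.
by move=> x0x; rewrite -hprod_rcons; [rewrite -cats1 -(nseqD n 1) addn1 | right].
Qed.

Lemma rpath_seq_pow v c n : closed_walk v c ->
  rpath v (seq_pow c n) = cycle_pow v c n%:Z.
Proof.
move=> cc; have [wc /eqP tc] := andP cc.
rewrite /cycle_pow lpath_rpath//; elim: n => // n IHn.
have /andP[_ /eqP tn] := closed_walk_pow n cc.
have c1 : seq_pow c 1 = c by rewrite /seq_pow /= cats0.
rewrite hprod_nseqS ?rpath_src// -IHn -addn1 seq_powD c1.
by rewrite rpath_cat tn.
Qed.

Lemma gpath_seq_pow v c n : closed_walk v c ->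
  gpath v (seq_pow c n) = cycle_pow v c (- n%:Z).
Proof.
move=> cc; have [wc /eqP tc] := andP cc.
have -> : cycle_pow v c (- n%:Z) = hprod (lvertex v) (nseq n (gpath v c)).
  by rewrite -(lpath_ghost_gpath wc) tc; case: n.
elim: n => // n IHn; have /andP[wn _] := closed_walk_pow n cc.
rewrite hprod_nseqS; last by rewrite -[X in lvertex X]tc gpath_tgt.
by rewrite -IHn [seq_pow c n.+1]/= gpath_cat tc.
Qed.

End LeavittPaths.

(** * Corners at a vertex *)

Section Corners.
Variable E : digraph.
Implicit Types (v w : vertex E) (e f : edge E) (p q c u g : seq (edge E)).

(** Since [u] ends at [v], [g^* u g] is the product of [g^*] with the
    walk [u ++ g], and [g^* u^* g] is its mirror image. *)
Lemma closed_corner0 v u g : closed_walk v u -> u != [::] -> walk v g ->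
    ~~ prefix g (u ++ g) ->
  gpath v g *h rpath v u *h rpath v g = 0 /\
  gpath v g *h gpath v u *h rpath v g = 0.
Proof.
case/andP=> wu /eqP tu u0 wg ngu.
have nug : ~~ prefix (u ++ g) g.
  apply/negP => /size_prefix; rewrite size_cat -[X in (_ <= X)%N]add0n leq_add2r.
  by rewrite leqn0 size_eq0 (negPf u0).
have wug : walk v (u ++ g) by rewrite walk_cat wu tu.
have rE : rpath v (u ++ g) = rpath v u *h rpath v g by rewrite rpath_cat tu.
have gE : gpath v (u ++ g) = gpath v g *h gpath v u by rewrite gpath_cat tu.
by rewrite -hmulA -rE -gE !gpath_rpath0.
Qed.

Definition loop v (x : leavitt E) : Prop :=
  exists u, [/\ closed_walk v u, u != [::] & x = rpath v u \/ x = gpath v u].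

(** The walk [g] is some [c ^ k a f], with [c = a e b].  A given loop can
    only survive the compression by one of these walks, because they are
    pairwise incomparable; with finitely many loops, a large [k] kills all. *)
Lemma exit_annihilates v a e b f (s : seq (leavitt E)) :
    closed_walk v (a ++ e :: b) -> src f = src e -> f != e ->
    {in s, forall x, loop v x} ->
  exists2 g, walk v g & gpath v g *h (\sum_(x <- s) x) *h rpath v g = 0.
Proof.
set c := a ++ e :: b => cc fe nfe sP.
pose g k := seq_pow c k ++ rcons a f.
have wg k : walk v (g k).
  have /andP[wk /eqP tk] := closed_walk_pow k cc.
  rewrite walk_cat wk tk -cats1 walk_cat /= fe andbT.
  by case/andP: cc; rewrite /c walk_cat /= => /and3P[-> ->].
suff [K Kg] : exists K, forall k, (K <= k)%N ->
    {in s, forall x, gpath v (g k) *h x *h rpath v (g k) = 0}.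
  exists (g K) => //; rewrite hmul_sumr hmul_suml.
  by rewrite big_seq big1// => x xs; apply: Kg.
elim: s sP => [|x s IHs] sP; first by exists 0.
have [K Ks] := IHs (fun y ys => sP y (mem_behead (s := x :: s) ys)).
have [u [cu u0 xu]] := sP x (mem_head x s).
suff [L Lx] : exists L, forall k, (L <= k)%N -> ~~ prefix (g k) (u ++ g k).
  exists (maxn L K) => k; rewrite geq_max => /andP[Lk Kk] y.
  rewrite inE => /orP[/eqP->|]; last exact: Ks.
  have [r0 g0] := closed_corner0 cu u0 (wg k) (Lx k Lk).
  by case: xu => ->.
case: (pselect (exists k, prefix (g k) (u ++ g k))) => [[k pk]|npk].
  exists k.+1 => l kl; apply/negP => pl.
  have sz : (size (g k) <= size (g l))%N.
    by rewrite !size_cat leq_add2r !size_seq_pow leq_mul2r (ltnW kl) orbT.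
  by have := prefix_periodic u0 sz pk pl; apply/negP/exit_walk_incomparable.
by exists 0 => k _; apply/negP => pk; apply: npk; exists k.
Qed.

Lemma no_exit_prefix v c p : (forall f, ~ is_exit c f) ->
  walk v c -> walk v p -> (size c <= size p)%N -> prefix c p.
Proof.
elim: c v p => [|e c IHc] v [|f p] //= nex /andP[/eqP<- wc] /andP[/eqP fe wp].
rewrite ltnS => cp; case: eqVneq => [ef|/eqP nef] /=; last first.
  case: (nex f); exists e; first by rewrite mem_head.
  by split=> // /esym.
apply: (IHc (tgt e)) => //; last by rewrite ef.
move=> h [e' e'c he']; apply: (nex h); exists e' => //.
by rewrite inE e'c orbT.
Qed.

(** Without exits, every step along [c] is forced, so a nonempty closed walk
    starts with [c]; then the rest is closed too and shorter. *)
Lemma no_exit_closed_walk v c u : (forall f, ~ is_exit c f) ->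
    c != [::] -> closed_walk v c ->
    (forall q, closed_walk v q -> q != [::] -> (size c <= size q)%N) ->
  closed_walk v u -> exists n, u = seq_pow c n.
Proof.
move=> nex c0 cc minc; have [n] := ubnP (size u).
elim: n u => // n IHn u; rewrite ltnS => un cu.
case: (eqVneq u [::]) => [->|u0]; first by exists 0.
have [[wc _] [wu _]] := (andP cc, andP cu).
have /prefixP[r ur] := no_exit_prefix nex wc wu (minc _ cu u0).
move: cu un; rewrite ur closed_walk_cat// size_cat => cr un.
have [|m ->] := IHn r _ cr; last by exists m.+1.
by apply: leq_trans un; rewrite -[X in (X < _)%N]add0n ltn_add2r lt0n size_eq0.
Qed.

Lemma laurent_of_seq (s : seq int) : exists p : laurent,
  (forall i, p i = (i \in s)) /\
  forall v c, laurent_eval p v c = \sum_(i <- s) cycle_pow v c i.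
Proof.
pose p : laurent := [fsfun i in [fset i in s]%fset => (true : boolean) | 0].
have pE i : p i = (i \in s) by rewrite /p fsfunE !inE /=; case: ifP.
exists p; split=> // v c; rewrite /laurent_eval -[RHS]big_undup; last exact: addhh.
rewrite [LHS](perm_big (undup s)) /=.
  by apply: eq_big_seq => i; rewrite mem_undup => si; rewrite pE si scale1r.
apply: uniq_perm; rewrite ?undup_uniq ?fset_uniq// => i.
by rewrite mem_undup mem_finsupp pE; case: (i \in s).
Qed.

(** The bound is on the shorter of the two walks since this is the length
    that compression by an edge decreases: a monomial with one trivial factor
    stays a closed walk or a ghost of one, of unchanged length. *)
Definition corner_monomial_upto N v (x : leavitt E) : Prop :=
  exists p q, [/\ walk v p, walk v q, wtgt v p = wtgt v q,
    x = rpath v p *h gpath v q & (minn (size p) (size q) <= N)%N].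

Lemma corner_monomial_upto0 v x : corner_monomial_upto 0 v x ->
  x = lvertex v \/ loop v x.
Proof.
case=> p [q [wp wq pq ->]]; rewrite leqn0.
case: p wp pq => [|e p] wp pq.
  case: q wq pq => [|f q] wq pq _; first by left; rewrite lvertexM_id.
  right; exists (f :: q); rewrite /closed_walk wq -pq eqxx; split=> //.
  by right; rewrite -[RHS]gpath_tgt -pq.
case: q wq pq => [|f q] wq pq; last by rewrite minnSS.
move=> _; right; exists (e :: p).
rewrite /closed_walk wp pq eqxx; split=> //.
by left; rewrite -[RHS]rpath_tgt pq.
Qed.

Lemma gpath_edge v f p e : walk v (f :: p) ->
  gpath v (f :: p) *h rpath v [:: e] = if f == e then gpath (tgt e) p else 0.
Proof.
case/andP=> _ wp; rewrite /= ledge_tgt -hmulA lghost_edge.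
by case: eqP => [<-|_]; rewrite ?hmulr0 ?gpath_src.
Qed.

Lemma edge_rpath v f p e : walk v (f :: p) ->
  gpath v [:: e] *h rpath v (f :: p) = if f == e then rpath (tgt e) p else 0.
Proof.
case/andP=> _ wp; rewrite /= ltgt_ghost hmulA lghost_edge eq_sym.
by case: eqP => [<-|_]; rewrite ?hmul0r ?rpath_src.
Qed.

(** When both factors are nontrivial, [e] cancels the first edge of each, or
    the result is 0.  When only one is, it is a closed walk starting with [e]
    (otherwise the result is 0), and the compression rotates it: its first edge
    [e] moves to the end. *)
Lemma corner_monomial_edge N e x : corner_monomial_upto N.+1 (src e) x ->
  sum_of (corner_monomial_upto N (tgt e))
    (gpath (src e) [:: e] *h x *h rpath (src e) [:: e]).
Proof.
set v := src e; have we : walk v [:: e] by rewrite /= eqxx.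
case=> p [q [wp wq pq -> pqN]].
rewrite (_ : _ *h _ = (gpath v [:: e] *h rpath v p) *h
                      (gpath v q *h rpath v [:: e])); last by rewrite !hmulA.
case: p wp pq pqN => [|f p] wp pq pqN; case: q wq pq pqN => [|h q] wq pq pqN.
- rewrite [rpath v [::]]/= [gpath v [::]]/= gpath_src// rpath_src//.
  rewrite gpath_edge// eqxx; apply: sum_of_gen; exists [::], [::].
  by rewrite /= lvertexM_id.
- rewrite [rpath v [::]]/= gpath_src// hmulA.
  have -> : gpath v [:: e] = gpath (wtgt v (h :: q)) [:: e] by rewrite -pq.
  rewrite -gpath_cat -?pq// [_ ++ _]/= gpath_edge; last first.
    by rewrite -cat_cons walk_cat wq -pq.
  case: eqP => [he|_]; last exact: sum_of0.
  move: wq pq; rewrite he => /andP[_ wq] pq.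
  have {}wq : walk (tgt e) q := wq.
  have {}pq : wtgt (tgt e) q = v := esym pq.
  have wqe : walk (tgt e) (q ++ [:: e]) by rewrite walk_cat wq pq /= /v eqxx.
  have tqe : wtgt (tgt e) (q ++ [:: e]) = tgt e by rewrite wtgt_cat.
  apply: sum_of_gen; exists [::], (q ++ [:: e]); rewrite /= min0n; split=> //.
  by rewrite -{2}tqe gpath_tgt.
- rewrite [gpath v [::]]/= rpath_src// -hmulA.
  have -> : rpath v [:: e] = rpath (wtgt v (f :: p)) [:: e] by rewrite pq.
  rewrite -rpath_cat ?pq// [_ ++ _]/= edge_rpath; last first.
    by rewrite -cat_cons walk_cat wp pq.
  case: eqP => [fe|_]; last exact: sum_of0.
  move: wp pq; rewrite fe => /andP[_ wp] pq.
  have {}wp : walk (tgt e) p := wp.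
  have {}pq : wtgt (tgt e) p = v := pq.
  have wpe : walk (tgt e) (p ++ [:: e]) by rewrite walk_cat wp pq /= /v eqxx.
  have tpe : wtgt (tgt e) (p ++ [:: e]) = tgt e by rewrite wtgt_cat.
  apply: sum_of_gen; exists (p ++ [:: e]), [::]; rewrite /= minn0; split=> //.
  by rewrite -{3}tpe rpath_tgt.
- rewrite edge_rpath// gpath_edge//.
  case: eqP => [fe|_]; last by rewrite hmul0r; apply: sum_of0.
  case: eqP => [he|_]; last by rewrite hmulr0; apply: sum_of0.
  move: wp wq pq pqN; rewrite fe he /= minnSS => /andP[_ wp] /andP[_ wq] pq pqN.
  by apply: sum_of_gen; exists p, q.
Qed.

End Corners.

(** * Reflection of the order *)

Section OrderReflection.
Variables (E : digraph) (A : hemialgType boolean) (phi : leavitt E -> A).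
Hypothesis rfE : row_finite E.
Hypothesis hom_phi : hemiring_hom phi.
Hypothesis phi_vertex : forall v : vertex E, phi (lvertex v) <> 0.
Hypothesis phi_cycle : forall (v : vertex E) (c : seq (edge E)),
  is_cycle v c -> (forall f : edge E, ~ is_exit c f) ->
  forall p q : laurent, p <> q ->
    phi (laurent_eval p v c) <> phi (laurent_eval q v c).
Implicit Types (v : vertex E) (x y z : leavitt E).

Lemma phi_corner_le v p z w q : walk v p -> walk w q -> wtgt v p = wtgt w q ->
    phi (rpath v p *h gpath w q) <=h phi z ->
  phi (lvertex (wtgt v p)) <=h phi (gpath v p *h z *h rpath w q).
Proof.
have [_ _ phiM] := hom_phi.
move=> wp wq pq /(hle_mull (phi (gpath v p))) /(hle_mulr (phi (rpath w q))).
rewrite -!phiM; congr (phi _ <=h _); rewrite -[p in rpath v p]cats0.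
rewrite hmulA gpath_rpath_cat ?cats0// -hmulA -[q in rpath w q]cats0.
by rewrite gpath_rpath_cat ?cats0//= -pq lvertexM_id.
Qed.

(** The two conditions of the theorem enter here: condition (1) when the
    shortest closed walk at [v] has an exit, condition (2) when it has none. *)
Lemma phi_loops v (s : seq (leavitt E)) : {in s, forall x, loop v x} ->
  ~ phi (lvertex v) <=h phi (\sum_(x <- s) x).
Proof.
have [phi0 phiD _] := hom_phi.
(* The empty sum has to be excluded for a closed walk at [v] to exist. *)
move=> sP vs; case: s sP vs => [_ vs|x0 s0].
  by move: vs; rewrite big_nil phi0 /hle addr0; apply: phi_vertex.
move: {s0}(x0 :: s0) (mem_head x0 s0) => s x0s sP vs.
have [u [cu u0 _]] := sP x0 x0s.
have [c [c0 cc minc]] := shortest_closed_walk cu u0.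
case: (pselect (exists f, is_exit c f)) => [[f [e ec [fe /eqP nfe]]]|nex].
  case/splitPr: ec cc {c0 minc} => a b cc.
  have [g wg gs] := exit_annihilates cc fe nfe sP.
  apply: (@phi_vertex (wtgt v g)).
  have: phi (rpath v g *h gpath v g) <=h phi (\sum_(x <- s) x).
    by apply: hle_trans vs; apply/(hom_hle hom_phi)/rpath_gpath_le.
  by move/(phi_corner_le wg wg erefl); rewrite gs phi0 /hle addr0.
have {}nex f : ~ is_exit c f by move=> fc; apply: nex; exists f.
have [t t0 st] : exists2 t : seq int, 0 \notin t &
    \sum_(x <- s) x = \sum_(i <- t) cycle_pow v c i.
  elim: s sP {x0 x0s vs} => [|x s IHs] sP; first by exists [::]; rewrite ?big_nil.
  have [t t0 st] := IHs (fun y ys => sP y (mem_behead (s := x :: s) ys)).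
  have [w [cw w0 xw]] := sP x (mem_head x s).
  have [[|n] wn] := no_exit_closed_walk nex c0 cc minc cw.
    by rewrite wn in w0.
  case: xw => ->; rewrite wn; [exists (n.+1%:Z :: t) | exists (- n.+1%:Z :: t)].
  - by rewrite inE negb_or t0.
  - by rewrite !big_cons st rpath_seq_pow.
  - by rewrite inE negb_or t0.
  - by rewrite !big_cons st gpath_seq_pow.
have [p [pE pc]] := laurent_of_seq E t.
have [q [qE qc]] := laurent_of_seq E (0 :: t).
apply: (phi_cycle (shortest_closed_walk_cycle c0 cc minc) nex (p := q) (q := p)).
  by move=> qp; move: (qE 0); rewrite qp pE (negPf t0) mem_head.
by rewrite pc qc big_cons -st phiD.
Qed.

(** Induction on the bound: a vertex that emits edges is the sum of its
    [e e^*], and each of them is dealt with after compression by [e]. *)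
Lemma phi_reflects_lvertex N v z : sum_of (corner_monomial_upto N v) z ->
  phi (lvertex v) <=h phi z -> lvertex v <=h z.
Proof.
elim: N v z => [|N IHN] v z.
  case/sum_of_seq => s sP ->.
  case: (boolP (lvertex v \in s)) => [vs _|nvs].
    exact: (hle_bigsum id).
  move=> vs; case: (phi_loops _ vs) => x xs.
  by case: (corner_monomial_upto0 (sP x xs)) => // xv; rewrite -xv xs in nvs.
case: (pselect (exists e, src e = v)) => [[e0 e0v] zP vz|sink zP]; last first.
  (* From a sink there are only trivial walks, so the bound is already 0. *)
  apply: IHN; apply: (sum_of_morph (f := id)) zP => //= x.
  case=> p [q [wp wq pq xE _]]; apply: sum_of_gen; exists p, q; split=> //.
  case: p wp {pq xE} => [|e p] /=; first by rewrite min0n.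
  by case/andP=> /eqP ev; case: sink; exists e.
rewrite (lvertex_outs rfE e0v); apply: hle_sum => e.
rewrite mem_outs// => /eqP ev; rewrite -{}ev in zP vz.
have we : walk (src e) [:: e] by rewrite /= eqxx.
have -> : ledge e *h lghost e = rpath (src e) [:: e] *h gpath (src e) [:: e].
  by rewrite /= ledge_tgt ltgt_ghost.
apply: corner_le => //; apply: IHN.
  apply: sum_of_sandwich zP; exact: corner_monomial_edge.
apply: phi_corner_le => //; apply: hle_trans vz.
exact/(hom_hle hom_phi)/rpath_gpath_le.
Qed.

Lemma sum_of_corner_upto v z : sum_of (monomial v v) z ->
  exists N, sum_of (corner_monomial_upto N v) z.
Proof.
elim=> [|x [p [q [wp wq pq ->]]]|x y _ [M Mx] _ [N Ny]].
- by exists 0; apply: sum_of0.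
- by exists (minn (size p) (size q)); apply: sum_of_gen; exists p, q.
- have wid K L t : (K <= L)%N -> sum_of (corner_monomial_upto K v) t ->
      sum_of (corner_monomial_upto L v) t.
    move=> KL; apply: (sum_of_morph (f := id)) => //= r.
    case=> p [q [wp wq pq rE pqK]]; apply: sum_of_gen; exists p, q; split=> //.
    exact: leq_trans pqK KL.
  exists (maxn M N); apply: sum_ofD.
    exact: wid (leq_maxl _ _) Mx.
  exact: wid (leq_maxr _ _) Ny.
Qed.

Lemma phi_reflects_le x y : phi x <=h phi y -> x <=h y.
Proof.
have [_ phiD _] := hom_phi.
elim: (sum_of_monomial x) => [_|{}x [v [w [p [q [wp wq pq ->]]]]] xy|].
- exact: hle0.
- apply: corner_le => //.
  have [N zN] := sum_of_corner_upto (corner_monomial y wp wq pq).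
  exact: phi_reflects_lvertex zN (phi_corner_le wp wq pq xy).
move=> {}x z _ IHx _ IHz; rewrite phiD => xz; apply: hle_add.
  exact: IHx (hle_trans (hle_addr _ _) xz).
exact: IHz (hle_trans (hle_addl _ _) xz).
Qed.

End OrderReflection.

(** * A graded model by relations *)

Section Model.
Variable E : digraph.
Implicit Types (v : vertex E) (e f : edge E) (c : seq (edge E)).

(** The natural number makes the states at a vertex an infinite set, which
    is a disjoint union of finitely many copies of itself; the integer only
    records degrees. *)
Definition state : Type := (vertex E * nat * int)%type.
Implicit Types (a b : state).

(** An edge acts as a partial injection, from the states at its target to
    the states at its source.  If [d] edges leave that source, the [i]-th one
    sends [n] to [n * d + i], so that the images of these edges form a partition
    of the states at the source. *)
Definition edge_rel e a b : Prop :=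
  b.1.1 = tgt e /\
  a = (src e, (b.1.2 * size (outs (src e)) + index e (outs (src e)))%N, b.2 + 1).

Definition gen_rel (g : lpa_generator E) a b : Prop :=
  match g with
  | inl v => a = b /\ a.1.1 = v
  | inr (inl e) => edge_rel e a b
  | inr (inr e) => edge_rel e b a
  end.

Fixpoint seq_rel (s : seq (lpa_generator E)) a b : Prop :=
  if s is g :: s' then exists2 d, gen_rel g a d & seq_rel s' d b else a = b.

Lemma seq_rel_cat s t a b :
  seq_rel (s ++ t) a b <-> exists2 d, seq_rel s a d & seq_rel t d b.
Proof.
elim: s a => [|g s IHs] a /=; first by split=> [|[d ->]]; [exists a|].
split=> [[d ad /IHs[h dh hb]]|[h [d ad dh] hb]].
  by exists h => //; exists d.
by exists d => //; apply/IHs; exists h.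
Qed.

Definition free_rel (x : free_alg (lpa_generator E)) a b : Prop :=
  exists2 w : nword (lpa_generator E),
    w \in (x : {fset _}) & seq_rel (w.1 :: w.2) a b.

Lemma free_rel0 a b : ~ free_rel 0 a b.
Proof. by case. Qed.

Lemma free_relD x y a b :
  free_rel (x + y) a b <-> free_rel x a b \/ free_rel y a b.
Proof.
split=> [[w /fsetUP[wx|wy] ab]|[[w wx ab]|[w wy ab]]].
- by left; exists w.
- by right; exists w.
- by exists w => //; apply/fsetUP; left.
- by exists w => //; apply/fsetUP; right.
Qed.

Lemma free_relM x y a b :
  free_rel (x *h y) a b <-> exists2 d, free_rel x a d & free_rel y d b.
Proof.
split=> [[_ /free_mulP[u ux [w wy ->]]]|[d [u ux ud] [w wy wb]]].
  rewrite -[_ :: _]/((u.1 :: u.2) ++ (w.1 :: w.2)) => /seq_rel_cat[d ud wb].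
  by exists d; [exists u | exists w].
exists (nword_cat u w); first by apply/free_mulP; exists u => //; exists w.
by rewrite -[_ :: _]/((u.1 :: u.2) ++ (w.1 :: w.2)); apply/seq_rel_cat; exists d.
Qed.

Lemma free_relZ (k : boolean) x a b :
  free_rel (k *: x) a b <-> k /\ free_rel x a b.
Proof. by case: k; split=> //; case. Qed.

Lemma free_rel_gen g a b : free_rel (free_gen g) a b <-> gen_rel g a b.
Proof.
split=> [[_ /fset1P -> [d ad <-]] //|ab]; exists (g, [::]); first exact/fset1P.
by exists b.
Qed.

(** Euclidean division recovers both the edge and the state from the image;
    this is the relation [e^* f = 0] for [e <> f], and [e^* e = tgt e]. *)
Lemma edge_rel_inj e f a b b' :
  row_finite E -> edge_rel e a b -> edge_rel f a b' -> e = f /\ b = b'.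
Proof.
move=> rf [be ->] [b'f] [ef].
have sz : (0 < size (outs (src f)))%N.
  by rewrite -has_predT; apply/hasP; exists f; rewrite ?mem_outs.
have lt_e : (index e (outs (src f)) < size (outs (src f)))%N.
  by rewrite index_mem mem_outs// ef.
have lt_f : (index f (outs (src f)) < size (outs (src f)))%N.
  by rewrite index_mem mem_outs.
rewrite ef => code /addIr deg.
have idx : index e (outs (src f)) = index f (outs (src f)).
  by have := congr1 (modn^~ (size (outs (src f)))) code; rewrite !modnMDl !modn_small.
have quo : b.1.2 = b'.1.2.
  have := congr1 (divn^~ (size (outs (src f)))) code.
  by rewrite !divnMDl // !divn_small // !addn0.
have eqf : e = f.
  have eo : e \in outs (src f) by rewrite mem_outs// ef.
  by rewrite -(nth_index f eo) idx nth_index// mem_outs.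
split=> //; case: b b' be b'f quo deg {code} => [[v n] k] [[w m] l] /= -> -> -> ->.
by rewrite eqf.
Qed.

(** Every number has a remainder modulo the number of outgoing edges; this is
    the decomposition of a regular vertex as the sum of its [e e^*]. *)
Lemma edge_rel_total v a : row_finite E -> regular v -> a.1.1 = v ->
  exists2 e, src e = v & exists b, edge_rel e a b.
Proof.
move=> rf [[e0 e0v] _] av; have {}e0v : src e0 = v := e0v.
have sz : (0 < size (outs v))%N.
  by rewrite -has_predT; apply/hasP; exists e0; rewrite ?mem_outs// e0v.
have lt_a : (a.1.2 %% size (outs v) < size (outs v))%N by rewrite ltn_mod.
pose e := nth e0 (outs v) (a.1.2 %% size (outs v)).
have ev : src e = v by apply/eqP; rewrite -mem_outs// mem_nth.
exists e => //; exists (tgt e, (a.1.2 %/ size (outs v))%N, a.2 - 1).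
split=> //=; rewrite ev subrK index_uniq ?fset_uniq// -divn_eq.
by case: a av {lt_a e ev} => [[w n] k] /= ->.
Qed.

Lemma free_rel_sum (I : eqType) (s : seq I) F a b :
  free_rel (\sum_(i <- s) F i) a b <-> exists2 i, i \in s & free_rel (F i) a b.
Proof.
elim: s => [|i s IHs]; first by rewrite big_nil; split=> [/free_rel0|[]].
rewrite big_cons free_relD IHs; split=> [[ab|[j js ab]]|[j]].
- by exists i; rewrite ?mem_head.
- by exists j; rewrite ?inE ?js ?orbT.
- by rewrite inE => /orP[/eqP-> | js] ab; [left | right; exists j].
Qed.

Lemma lpa_rel_free_rel x y a b : row_finite E ->
  lpa_rel x y -> free_rel x a b <-> free_rel y a b.
Proof.
move=> rf; case=> {x y} [v w|e|e|e|e|e f|v reg].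
- rewrite free_relM free_relZ free_rel_gen.
  split=> [[d /free_rel_gen[<- dv] /free_rel_gen[<- aw]]|[/eqP <- [-> bv]]].
    by split=> //; rewrite -dv -aw eqxx.
  by exists b; apply/free_rel_gen.
- rewrite free_relM free_rel_gen.
  split=> [[d /free_rel_gen[-> _] /free_rel_gen]//|ab].
  by exists a; apply/free_rel_gen => //; split=> //; case: ab => _ ->.
- rewrite free_relM free_rel_gen.
  split=> [[d /free_rel_gen ad /free_rel_gen[<-]]//|ab].
  by exists b; apply/free_rel_gen => //; split=> //; case: ab.
- rewrite free_relM free_rel_gen.
  split=> [[d /free_rel_gen[-> _] /free_rel_gen]//|ab].
  by exists a; apply/free_rel_gen => //; split=> //; case: ab.
- rewrite free_relM free_rel_gen.
  split=> [[d /free_rel_gen ad /free_rel_gen[<-]]//|ab].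
  by exists b; apply/free_rel_gen => //; split=> //; case: ab => _ ->.
- rewrite free_relM free_relZ free_rel_gen.
  split=> [[d /free_rel_gen da /free_rel_gen db]|[/eqP <- [<- ae]]].
    have [ef ab] := edge_rel_inj rf da db.
    by split; [apply/eqP | split=> //; case: da].
  by exists (src e, (a.1.2 * size (outs (src e)) + index e (outs (src e)))%N, a.2 + 1);
    apply/free_rel_gen; split.
- rewrite fsbig_finite ?rf// free_rel_sum free_rel_gen.
  split=> [[<- av]|[e ev /free_relM[d /free_rel_gen ad /free_rel_gen bd]]].
    have [e ev [d ad]] := edge_rel_total rf reg av.
    exists e; first by rewrite -[_ \in _]/(e \in outs v) mem_outs// ev.
    by apply/free_relM; exists d; apply/free_rel_gen.
  move: ev; rewrite -[_ \in _]/(e \in outs v) mem_outs// => /eqP ev.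
  by case: ad bd => _ -> [_ ->].
Qed.

Lemma congr_free_rel x y a b : row_finite E ->
  congr_gen (@lpa_rel E) x y -> free_rel x a b <-> free_rel y a b.
Proof.
move=> rf xy; elim: xy a b => {x y}.
- by move=> x y xy a b; apply: lpa_rel_free_rel.
- by [].
- by move=> x y _ IH a b; rewrite IH.
- by move=> x y z _ IHxy _ IHyz a b; rewrite IHxy.
- by move=> x x' y y' _ IHx _ IHy a b; rewrite !free_relD IHx IHy.
- by move=> k x x' _ IH a b; rewrite !free_relZ IH.
- move=> x x' y y' _ IHx _ IHy a b; rewrite !free_relM.
  by split=> -[d /IHx ad /IHy db]; exists d.
Qed.

Definition lrel (x : leavitt E) : state -> state -> Prop := free_rel (repr x).

Hypothesis rf : row_finite E.

Lemma lrel_proj x a b : lrel (quot_proj (@lpa_rel E) x) a b <-> free_rel x a b.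
Proof. exact/congr_free_rel/repr_congr. Qed.

Lemma lrel0 a b : ~ lrel 0 a b.
Proof. by move/lrel_proj/free_rel0. Qed.

Lemma lrelD x y a b : lrel (x + y) a b <-> lrel x a b \/ lrel y a b.
Proof.
elim/quot_ind: x => x; elim/quot_ind: y => y.
by rewrite -quot_projD !lrel_proj free_relD.
Qed.

Lemma lrelM x y a b : lrel (x *h y) a b <-> exists2 d, lrel x a d & lrel y d b.
Proof.
elim/quot_ind: x => x; elim/quot_ind: y => y.
rewrite -quot_projM lrel_proj free_relM.
by split=> -[d /lrel_proj ad /lrel_proj db]; exists d.
Qed.

Lemma lrelZ (k : boolean) x a b : lrel (k *: x) a b <-> k /\ lrel x a b.
Proof.
by elim/quot_ind: x => x; rewrite -quot_projZ !lrel_proj free_relZ.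
Qed.

Lemma lrel_vertex v a b : lrel (lvertex v) a b <-> a = b /\ a.1.1 = v.
Proof. by rewrite lrel_proj free_rel_gen. Qed.

Lemma lrel_edge e a b : lrel (ledge e) a b <-> edge_rel e a b.
Proof. by rewrite lrel_proj free_rel_gen. Qed.

Lemma lrel_ghost e a b : lrel (lghost e) a b <-> edge_rel e b a.
Proof. by rewrite lrel_proj free_rel_gen. Qed.

Lemma lrel_sum (I : Type) (s : seq I) F a b :
  lrel (\sum_(i <- s) F i) a b -> exists i, lrel (F i) a b.
Proof.
elim: s => [|i s IHs]; first by rewrite big_nil => /lrel0.
by rewrite big_cons lrelD => -[ab|/IHs//]; exists i.
Qed.

Lemma lvertex_neq0 v : lvertex v <> 0.
Proof.
have : lrel (lvertex v) (v, 0%N, 0) (v, 0%N, 0) by apply/lrel_vertex.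
by move=> vv v0; rewrite v0 in vv; apply: lrel0 vv.
Qed.

Lemma lrel_gpath v p a b : lrel (gpath v p) a b <-> lrel (rpath v p) b a.
Proof.
elim: p v a b => [|e p IHp] v a b /=.
  by rewrite !lrel_vertex; split=> -[->].
rewrite !lrelM; split=> -[d].
  by move=> /IHp ad /lrel_ghost db; exists d => //; apply/lrel_edge.
by move=> /lrel_edge ad /IHp db; exists d => //; apply/lrel_ghost.
Qed.

Lemma lrel_rpath_degree v p a b : lrel (rpath v p) a b -> a.2 = b.2 + (size p)%:Z.
Proof.
elim: p v a => [|e p IHp] v a /=.
  by rewrite lrel_vertex => -[-> _]; rewrite addr0.
rewrite lrelM => -[d /lrel_edge[_ ->] /IHp /= ->].
by rewrite intS (addrC 1) addrA.
Qed.

Lemma lrel_rpath_total v p b : walk v p -> b.1.1 = wtgt v p ->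
  exists a, lrel (rpath v p) a b.
Proof.
move=> wp bp; suff [a [_ ab]] : exists a, a.1.1 = v /\ lrel (rpath v p) a b.
  by exists a.
elim: p v wp bp => [|e p IHp] v /=; first by exists b; rewrite lrel_vertex.
case/andP=> /eqP ev wp /(IHp _ wp)[d [de db]].
pose a : state :=
  (src e, (d.1.2 * size (outs (src e)) + index e (outs (src e)))%N, d.2 + 1).
exists a; split=> //; apply/lrelM; exists d => //.
exact/lrel_edge.
Qed.

Lemma lrel_cycle_pow_degree v c i a b : closed_walk v c ->
  lrel (cycle_pow v c i) a b -> a.2 = b.2 + i * (size c)%:Z.
Proof.
move=> cc; case: (intP i) => [|n|n].
- by rewrite lrel_vertex mul0r addr0 => -[->].
- rewrite -rpath_seq_pow// => /lrel_rpath_degree ->.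
  by rewrite size_seq_pow PoszM.
- rewrite -gpath_seq_pow// => /lrel_gpath /lrel_rpath_degree ->.
  by rewrite size_seq_pow PoszM mulNr addrK.
Qed.

Lemma lrel_cycle_pow_neq0 v c i : closed_walk v c ->
  exists a b, lrel (cycle_pow v c i) a b.
Proof.
have total n : closed_walk v c -> exists a b, lrel (rpath v (seq_pow c n)) a b.
  case/(closed_walk_pow n)/andP=> wn /eqP tn.
  have [|a ab] := @lrel_rpath_total v (seq_pow c n) (v, 0%N, 0) wn _ => //.
  by exists a, (v, 0%N, 0).
move=> cc; case: i => n.
  by have [a [b ab]] := total n cc; exists a, b; rewrite -rpath_seq_pow.
have [a [b ab]] := total n.+1 cc; exists b, a.
by rewrite NegzE -gpath_seq_pow//; apply/lrel_gpath.
Qed.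

(** A power of [c] relates some pair of states, and only pairs whose degrees
    differ by the exponent times the length of [c]: so the exponents occurring in
    a value [p(c)] can be read off from it. *)
Lemma laurent_coef_le v c (p q : laurent) i : c != [::] -> closed_walk v c ->
  laurent_eval p v c = laurent_eval q v c -> p i -> q i.
Proof.
move=> c0 cc pq pi.
have [a [b ab]] := lrel_cycle_pow_neq0 i cc.
have : lrel (laurent_eval q v c) a b.
  rewrite -pq /laurent_eval (big_rem i) /=; last first.
    by rewrite mem_finsupp; case: (p i) pi.
  by apply/lrelD; left; apply/lrelZ.
case/lrel_sum => j /lrelZ[qj jb].
have := lrel_cycle_pow_degree cc jb; rewrite (lrel_cycle_pow_degree cc ab).
move/addrI/mulIf => -> //.
by rewrite eqz_nat size_eq0.
Qed.

Lemma laurent_eval_inj v c (p q : laurent) : is_cycle v c ->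
  laurent_eval p v c = laurent_eval q v c -> p = q.
Proof.
case/is_cycle_closed_walk => c0 cc _ pq; apply/fsfunP => i.
have := laurent_coef_le (i := i) c0 cc pq.
have := laurent_coef_le (i := i) c0 cc (esym pq).
by case: (p i) (q i) => -[] // qp pq'; [have := pq' isT | have := qp isT].
Qed.

End Model.

Theorem corollary4p7 (E : digraph) (A : hemialgType boolean)
    (phi : leavitt E -> A) :
  row_finite E ->
  hemiring_hom phi ->
  injective phi <->
  (forall v : vertex E, phi (lvertex v) <> 0) /\
  (forall (v : vertex E) (c : seq (edge E)),
     is_cycle v c -> (forall f : edge E, ~ is_exit c f) ->
     forall p q : laurent, p <> q ->
       phi (laurent_eval p v c) <> phi (laurent_eval q v c)).
Proof.
move=> rf hom_phi; have [phi0 _ _] := hom_phi.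
split=> [inj|[phi_vertex phi_cycle] x y xy].
  split=> [v|v c cyc _ p q pq]; last by move/inj/(laurent_eval_inj rf cyc).
  by rewrite -phi0 => /inj /(lvertex_neq0 rf).
by apply: hle_anti; apply: (phi_reflects_le rf hom_phi) => //;
  rewrite xy; apply: hle_refl.
Qed.
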